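(* In BISH, assume $\mathbf{POS}^{[0,1]}$. Let $X$ be a compact metric space, and let $f$ be a Z-stable, uniformly continuous mapping of $X$ into a normed space $Y$ such that $Z_f=\{x\in X:f(x)=0\}$ is inhabited and located in $X$. Then $f$ is uniformly Z-stable on $X$.
   Context: The setting is Bishop-style constructive mathematics (BISH): intuitionistic logic together with dependent choice; neither the law of excluded middle, nor LPO, nor Markov's principle may be used. A metric space is compact if it is complete and totally bounded. $\rho$ denotes the metric on $X$. For $x\in X$, $S\subset X$ and $\varepsilon>0$, the expression $\rho(x,S)<\varepsilon$ means that there exists $y\in S$ with $\rho(x,y)<\varepsilon$. A subset $S$ of $X$ is located if the distance $\rho(x,S)=\inf\{\rho(x,y):y\in S\}$ exists for each $x\in X$. For $f:X\to Y$ with zero set $Z_f=\{x\in X:f(x)=0\}$: - $f$ is Z-stable at the point $x\in X$ if for each $\varepsilon>0$ there exists $\delta>0$ such that if $\|f(x)\|<\delta$, then $\rho(x,Z_f)<\varepsilon$; - $f$ is Z-stable (on $X$) if it is Z-stable at each point of $X$; - $f$ is uniformly Z-stable on $X$ if for each $\varepsilon>0$ there exists $\delta>0$ such that for each $x\in X$, if $\|f(x)\|<\delta$, then $\rho(x,Z_f)<\varepsilon$. $\mathbf{POS}^{[0,1]}$ is the statement: if $g:[0,1]\to\mathbf{R}$ is uniformly continuous and positive-valued ($g(x)>0$ for each $x$), then $\inf_{[0,1]}g$ exists and is positive. Here $m=\inf g$ means that $m\le g(x)$ for all $x$ and that for each $\varepsilon>0$ there exists $x$ with $g(x)<m+\varepsilon$.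 *)

(* Defs.v *)
From Stdlib Require Import QArith List Setoid Morphisms ChoiceFacts.
From Stdlib Require Import ConstructiveReals ConstructiveAbs.

(* The ambient logic is Rocq's intuitionistic logic without axioms, with
   existence and disjunction read in [Prop], so that choice principles are not
   available for free: dependent choice has to be assumed explicitly
   ([FunctionalDependentChoice] of ChoiceFacts).  The real numbers are an
   arbitrary implementation of the interface [ConstructiveReals].  Sets carry
   their own equality relation. *)

Declare Scope bish_scope.
Delimit Scope bish_scope with bish.

(* [CRlt] lives in [Set]; [CRltProp] is its truncation to [Prop], and the two
   are interderivable by [CRltForget] and [CRltEpsilon]. *)
Notation "x < y" := (CRltProp _ x y) : bish_scope.

Local Open Scope ConstructiveReals.
Local Open Scope bish_scope.

Record MetricSpace (R : ConstructiveReals) : Type := {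
  ms_carrier :> Type;
  ms_eq : ms_carrier -> ms_carrier -> Prop;
  dist : ms_carrier -> ms_carrier -> CRcarrier R;
  ms_equiv : Equivalence ms_eq;
  dist_nonneg : forall x y, 0 <= dist x y;
  dist_eq0 : forall x y, dist x y == 0 <-> ms_eq x y;
  dist_sym : forall x y, dist x y == dist y x;
  dist_triangle : forall x y z, dist x z <= dist x y + dist y z
}.
Arguments ms_eq {R X} : rename.
Arguments dist {R X} : rename.

Record NormedSpace (R : ConstructiveReals) : Type := {
  ns_carrier :> Type;
  ns_eq : ns_carrier -> ns_carrier -> Prop;
  ns_zero : ns_carrier;
  ns_add : ns_carrier -> ns_carrier -> ns_carrier;
  ns_opp : ns_carrier -> ns_carrier;
  ns_scale : CRcarrier R -> ns_carrier -> ns_carrier;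
  norm : ns_carrier -> CRcarrier R;
  ns_equiv : Equivalence ns_eq;
  ns_add_proper : Proper (ns_eq ==> ns_eq ==> ns_eq) ns_add;
  ns_opp_proper : Proper (ns_eq ==> ns_eq) ns_opp;
  ns_scale_proper : Proper (CReq R ==> ns_eq ==> ns_eq) ns_scale;
  norm_proper : Proper (ns_eq ==> CReq R) norm;
  ns_add_assoc : forall u v w, ns_eq (ns_add u (ns_add v w)) (ns_add (ns_add u v) w);
  ns_add_comm : forall u v, ns_eq (ns_add u v) (ns_add v u);
  ns_add_zero : forall u, ns_eq (ns_add ns_zero u) u;
  ns_add_opp : forall u, ns_eq (ns_add u (ns_opp u)) ns_zero;
  ns_scale_one : forall u, ns_eq (ns_scale 1 u) u;
  ns_scale_mult : forall a b u, ns_eq (ns_scale (a * b) u) (ns_scale a (ns_scale b u));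
  ns_scale_add_l : forall a b u,
    ns_eq (ns_scale (a + b) u) (ns_add (ns_scale a u) (ns_scale b u));
  ns_scale_add_r : forall a u v,
    ns_eq (ns_scale a (ns_add u v)) (ns_add (ns_scale a u) (ns_scale a v));
  norm_nonneg : forall u, 0 <= norm u;
  norm_eq0 : forall u, norm u == 0 <-> ns_eq u ns_zero;
  norm_scale : forall a u, norm (ns_scale a u) == CRabs R a * norm u;
  norm_triangle : forall u v, norm (ns_add u v) <= norm u + norm v
}.
Arguments ns_eq {R Y} : rename.
Arguments ns_zero {R Y} : rename.
Arguments ns_add {R Y} : rename.
Arguments ns_opp {R Y} : rename.
Arguments ns_scale {R Y} : rename.
Arguments norm {R Y} : rename.

Section NormedMetric.
Context {R : ConstructiveReals} (Y : NormedSpace R).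

#[local] Existing Instance ns_equiv.
#[local] Existing Instance ns_add_proper.
#[local] Existing Instance ns_opp_proper.
#[local] Existing Instance ns_scale_proper.
#[local] Existing Instance norm_proper.

Lemma ns_sub_eq0 (u v : Y) : ns_eq (ns_add u (ns_opp v)) ns_zero <-> ns_eq u v.
Proof.
  split; intro H.
  - rewrite <- (ns_add_zero _ _ u), <- (ns_add_opp _ _ v).
    rewrite (ns_add_comm _ _ v), <- ns_add_assoc.
    rewrite (ns_add_comm _ _ v), ns_add_assoc.
    rewrite (ns_add_comm _ _ (ns_opp v)), H.
    apply ns_add_zero.
  - rewrite H. apply ns_add_opp.
Qed.

Lemma ns_add_cancel (u v w : Y) : ns_eq (ns_add u v) (ns_add u w) -> ns_eq v w.
Proof.
  intro H.
  rewrite <- (ns_add_zero _ _ v), <- (ns_add_zero _ _ w), <- (ns_add_opp _ _ u).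
  rewrite (ns_add_comm _ _ u), <- !ns_add_assoc, H. reflexivity.
Qed.

Lemma ns_scale_zero_l (u : Y) : ns_eq (ns_scale 0 u) ns_zero.
Proof.
  apply (ns_add_cancel (ns_scale 0 u)).
  rewrite <- ns_scale_add_l, CRplus_0_l, ns_add_comm, ns_add_zero. reflexivity.
Qed.

Lemma ns_opp_scale (u : Y) : ns_eq (ns_opp u) (ns_scale (- (1)) u).
Proof.
  apply (ns_add_cancel u). rewrite ns_add_opp.
  rewrite <- (ns_scale_one _ _ u) at 1.
  rewrite <- ns_scale_add_l, CRplus_opp_r, ns_scale_zero_l. reflexivity.
Qed.

Lemma norm_opp (u : Y) : norm (ns_opp u) == norm u.
Proof.
  rewrite ns_opp_scale, norm_scale, CRabs_opp, CRabs_right, CRmult_1_l.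
  - reflexivity.
  - apply CRlt_asym, CRzero_lt_one.
Qed.

Lemma ns_opp_sub (u v : Y) :
  ns_eq (ns_opp (ns_add u (ns_opp v))) (ns_add v (ns_opp u)).
Proof.
  apply (ns_add_cancel (ns_add u (ns_opp v))). rewrite ns_add_opp.
  rewrite <- ns_add_assoc, (ns_add_assoc _ _ (ns_opp v)).
  rewrite (ns_add_comm _ _ (ns_opp v)), ns_add_opp, ns_add_zero, ns_add_opp.
  reflexivity.
Qed.

Lemma ns_sub_sub (u v w : Y) :
  ns_eq (ns_add (ns_add u (ns_opp v)) (ns_add v (ns_opp w))) (ns_add u (ns_opp w)).
Proof.
  rewrite <- ns_add_assoc, (ns_add_assoc _ _ (ns_opp v)).
  rewrite (ns_add_comm _ _ (ns_opp v)), ns_add_opp, ns_add_zero. reflexivity.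
Qed.

Definition normed_metric : MetricSpace R.
Proof.
  refine {| ms_carrier := Y; ms_eq := ns_eq;
            dist := fun u v => norm (ns_add u (ns_opp v)) |}.
  - intros; apply norm_nonneg.
  - intros u v. rewrite norm_eq0. apply ns_sub_eq0.
  - intros u v. rewrite <- norm_opp, ns_opp_sub. reflexivity.
  - intros u v w. rewrite <- (ns_sub_sub u v w). apply norm_triangle.
Defined.
End NormedMetric.

Lemma CR_sub_eq0 {R : ConstructiveReals} (x y : CRcarrier R) :
  CRabs R (x - y) == 0 <-> x == y.
Proof.
  split; intro H.
  - assert (H1 : x - y <= 0).
    { rewrite <- H. apply CRle_abs. }
    assert (H2 : y - x <= 0).
    { rewrite <- H, CRabs_minus_sym. apply CRle_abs. }
    unfold CReq. split.
    + apply (CRplus_le_reg_r (- x)). rewrite CRplus_opp_r. exact H2.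
    + apply (CRplus_le_reg_r (- y)). rewrite CRplus_opp_r. exact H1.
  - rewrite H. unfold CRminus. rewrite CRplus_opp_r.
    apply CRabs_right, CRle_refl.
Qed.

Definition real_metric (R : ConstructiveReals) : MetricSpace R.
Proof.
  refine {| ms_carrier := CRcarrier R; ms_eq := CReq R;
            dist := fun x y => CRabs R (x - y) |}.
  - intros; apply CRabs_pos.
  - intros; apply CR_sub_eq0.
  - intros; apply CRabs_minus_sym.
  - intros x y z.
    assert (E : x - z == (x - y) + (y - z)).
    { unfold CRminus. rewrite CRplus_assoc, <- (CRplus_assoc (- y) y).
      rewrite CRplus_opp_l, CRplus_0_l. reflexivity. }
    rewrite E. apply CRabs_triang.
Defined.

Definition subspace {R : ConstructiveReals} (X : MetricSpace R) (S : X -> Prop) :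
  MetricSpace R.
Proof.
  refine {| ms_carrier := {x : X | S x};
            ms_eq := fun x y => ms_eq (proj1_sig x) (proj1_sig y);
            dist := fun x y => dist (proj1_sig x) (proj1_sig y) |}.
  - destruct (ms_equiv _ X) as [r s t]. split; red; intros; eauto.
  - intros; apply dist_nonneg.
  - intros; apply dist_eq0.
  - intros; apply dist_sym.
  - intros; apply dist_triangle.
Defined.

Definition unit_interval (R : ConstructiveReals) : MetricSpace R :=
  subspace (real_metric R) (fun x : CRcarrier R => 0 <= x /\ x <= 1).

(* Such an [f] automatically respects the equalities of [X] and [Y]. *)
Definition uniformly_continuous {R : ConstructiveReals} {X Y : MetricSpace R}
    (f : X -> Y) : Prop :=
  forall eps : CRcarrier R, 0 < eps ->
  exists delta : CRcarrier R, 0 < delta /\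
    forall x x' : X, dist x x' < delta -> dist (f x) (f x') < eps.

Definition cauchy {R : ConstructiveReals} {X : MetricSpace R} (u : nat -> X) : Prop :=
  forall eps : CRcarrier R, 0 < eps ->
  exists N : nat, forall m n : nat, le N m -> le N n -> dist (u m) (u n) < eps.

Definition converges_to {R : ConstructiveReals} {X : MetricSpace R}
    (u : nat -> X) (l : X) : Prop :=
  forall eps : CRcarrier R, 0 < eps ->
  exists N : nat, forall n : nat, le N n -> dist (u n) l < eps.

Definition complete {R : ConstructiveReals} (X : MetricSpace R) : Prop :=
  forall u : nat -> X, cauchy u -> exists l : X, converges_to u l.

Definition totally_bounded {R : ConstructiveReals} (X : MetricSpace R) : Prop :=
  forall eps : CRcarrier R, 0 < eps ->
  exists s : list X, forall x : X, exists y : X, In y s /\ dist x y < eps.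

Definition compact {R : ConstructiveReals} (X : MetricSpace R) : Prop :=
  complete X /\ totally_bounded X.

(* [m] is the infimum of [h i] over those [i] with [S i]. *)
Definition is_inf {R : ConstructiveReals} {I : Type} (S : I -> Prop)
    (h : I -> CRcarrier R) (m : CRcarrier R) : Prop :=
  (forall i : I, S i -> m <= h i) /\
  (forall eps : CRcarrier R, 0 < eps -> exists i : I, S i /\ h i < m + eps).

Definition located {R : ConstructiveReals} {X : MetricSpace R} (S : X -> Prop) : Prop :=
  forall x : X, exists d : CRcarrier R, is_inf S (fun y => dist x y) d.

(* The relation rho(x,S) < eps; it does not presuppose that S is located. *)
Definition dist_to_lt {R : ConstructiveReals} {X : MetricSpace R}
    (x : X) (S : X -> Prop) (eps : CRcarrier R) : Prop :=
  exists y : X, S y /\ dist x y < eps.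

Definition zero_set {R : ConstructiveReals} {X : MetricSpace R} {Y : NormedSpace R}
    (f : X -> Y) : X -> Prop :=
  fun x => ns_eq (f x) ns_zero.

Definition Z_stable_at {R : ConstructiveReals} {X : MetricSpace R} {Y : NormedSpace R}
    (f : X -> Y) (x : X) : Prop :=
  forall eps : CRcarrier R, 0 < eps ->
  exists delta : CRcarrier R, 0 < delta /\
    (norm (f x) < delta -> dist_to_lt x (zero_set f) eps).

Definition Z_stable {R : ConstructiveReals} {X : MetricSpace R} {Y : NormedSpace R}
    (f : X -> Y) : Prop :=
  forall x : X, Z_stable_at f x.

Definition uniformly_Z_stable {R : ConstructiveReals} {X : MetricSpace R}
    {Y : NormedSpace R} (f : X -> Y) : Prop :=
  forall eps : CRcarrier R, 0 < eps ->
  exists delta : CRcarrier R, 0 < delta /\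
    forall x : X, norm (f x) < delta -> dist_to_lt x (zero_set f) eps.

Definition POS01 (R : ConstructiveReals) : Prop :=
  forall g : unit_interval R -> real_metric R,
    uniformly_continuous g ->
    (forall x : unit_interval R, 0 < g x) ->
    exists m : CRcarrier R, is_inf (fun _ => True) g m /\ 0 < m.

(* Main.v *)
(* Fix eps > 0 and put h(x) = max(|f(x)|, eps - rho(x, Z_f)).  Z-stability at x
   says exactly that h(x) > 0: either |f(x)| > 0, or |f(x)| is so small that
   rho(x, Z_f) < eps.  A positive lower bound m of h on X is what is needed, since
   |f(x)| < m then forces eps - rho(x, Z_f) >= m.

   To pass from [0,1] to a compact X, finite nets of X are arranged in a finitely
   branching tree whose branches converge to points of X, with each value of h close
   to its parent's.  The nodes u of the tree are placed at rational points p_u of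
   [0,1], siblings far apart compared with the distance from parent to child, and
     g(t) = lim_n min(1, min over nodes u of level n of (h_u + |t - p_u|)).
   For every real t one can choose a branch whose nodes are the only ones that may be
   close to t; it converges to some l in X, and h(l) > 0 yields g(t) > 0.  POS bounds
   g below, and g(p_u) is at most h_u up to an error that tends to 0. *)
Require Import Defs.
From Stdlib Require Import ChoiceFacts ConstructiveReals.
From Stdlib Require Import QArith PeanoNat Lqa Lia List Ring ConstructiveAbs ConstructiveMinMax ConstructiveLimits.

Local Open Scope ConstructiveReals.
Local Open Scope bish_scope.

(* Restates [CRisRing] with [CRminus], the form of subtraction that [ring] meets. *)
Lemma CR_ring_theory (R : ConstructiveReals) :
  ring_theory (CR_of_Q R 0) (CR_of_Q R 1) (CRplus R) (CRmult R) (CRminus R) (CRopp R) (CReq R).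
Proof. exact (CRisRing R). Qed.

Lemma CR_of_Q_ring_morph (R : ConstructiveReals) :
  ring_morph (CR_of_Q R 0) (CR_of_Q R 1) (CRplus R) (CRmult R) (CRminus R) (CRopp R) (CReq R)
    0%Q 1%Q Qplus Qmult Qminus Qopp Qeq_bool (CR_of_Q R).
Proof.
  split; try reflexivity.
  - apply CR_of_Q_plus.
  - intros. unfold Qminus, CRminus. rewrite CR_of_Q_plus, CR_of_Q_opp. reflexivity.
  - apply CR_of_Q_mult.
  - apply CR_of_Q_opp.
  - intros p q H. apply CR_of_Q_morph, Qeq_bool_eq, H.
Qed.

Ltac CR_constant t :=
  match t with
  | CR_of_Q _ ?q => match isQcst q with true => q | _ => InitialRing.NotConstant end
  | _ => InitialRing.NotConstant
  end.

(** * Order and linear inequalities of constructive reals *)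

Section Reals.
Context {R : ConstructiveReals}.
Add Ring CR_ring : (CR_ring_theory R)
  (morphism (CR_of_Q_ring_morph R), setoid (@CReq_rel R) (CRisRingExt R),
   constants [CR_constant]).

Local Notation inj := (CR_of_Q R).

Lemma CRltProp_le {x y : CRcarrier R} : x < y -> x <= y.
Proof. intro H. apply CRlt_asym, CRltEpsilon, H. Qed.

Lemma CRltProp_le_trans (x y z : CRcarrier R) : x < y -> y <= z -> x < z.
Proof. intros H H'. apply CRltForget, (CRlt_le_trans _ y); [apply CRltEpsilon, H | exact H']. Qed.

Lemma CRle_ltProp_trans (x y z : CRcarrier R) : x <= y -> y < z -> x < z.
Proof. intros H H'. apply CRltForget, (CRle_lt_trans _ y); [exact H | apply CRltEpsilon, H']. Qed.

Lemma CRltProp_cotrans (x y z : CRcarrier R) : x < z -> x < y \/ y < z.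
Proof.
  intro H. destruct (snd (CRltLinear R) x y z (CRltEpsilon R _ _ H)) as [h | h];
    [left | right]; apply CRltForget, h.
Qed.

Lemma CRle_not_ltProp (x y : CRcarrier R) : (y < x -> False) -> x <= y.
Proof. intros H h. apply H, CRltForget, h. Qed.

Lemma CRle_ltProp_absurd (x y : CRcarrier R) : x <= y -> y < x -> False.
Proof. intros H h. apply H, CRltEpsilon, h. Qed.

Lemma CRle_plus {a b c d : CRcarrier R} : a <= b -> c <= d -> a + c <= b + d.
Proof. apply CRplus_le_compat. Qed.

Lemma CRltProp_plus {a b c d : CRcarrier R} : a < b -> c <= d -> a + c < b + d.
Proof. intros H H'. apply CRltForget, CRplus_lt_le_compat; [apply CRltEpsilon, H | exact H']. Qed.

(** The basis of the tactic [linear]: hypotheses are added up into one inequality, and what remains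
    is a ring identity. The factor [k] clears fractions, so that hypotheses are repeated rather than
    scaled. *)
Lemma CRltProp_of_scaled_sub (k : Q) (x y a b : CRcarrier R) :
  (0 < k)%Q -> a < b -> inj k * (y - x) == b - a -> x < y.
Proof.
  intros k_pos H E. apply CRltForget.
  apply (CRmult_lt_reg_l (inj k)); [apply CR_of_Q_lt, k_pos |].
  apply (CRplus_lt_reg_r (b - a - inj k * x)).
  setoid_replace (inj k * x + (b - a - inj k * x)) with (b - a) by ring.
  setoid_replace (inj k * y + (b - a - inj k * x)) with (inj k * (y - x) + (b - a)) by ring.
  rewrite E. apply CRltEpsilon in H.
  apply (CRplus_lt_reg_r (a - (b - a))).
  setoid_replace (b - a + (a - (b - a))) with a by ring.
  setoid_replace (b - a + (b - a) + (a - (b - a))) with b by ring.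
  exact H.
Qed.

Lemma CRle_of_scaled_sub (k : Q) (x y a b : CRcarrier R) :
  (0 < k)%Q -> a <= b -> inj k * (y - x) == b - a -> x <= y.
Proof.
  intros k_pos H E. apply CRle_not_ltProp. intro h.
  apply (CRle_ltProp_absurd _ _ H).
  apply (CRltProp_of_scaled_sub (/ k) b a y x).
  - apply Qinv_lt_0_compat, k_pos.
  - exact h.
  - setoid_replace (a - b) with (- (inj k * (y - x))) by (rewrite E; ring).
    setoid_replace (inj (/ k) * - (inj k * (y - x))) with (inj (/ k) * inj k * (x - y)) by ring.
    rewrite <- CR_of_Q_mult.
    setoid_replace (/ k * k)%Q with 1%Q; [ring |].
    rewrite Qmult_comm. apply Qmult_inv_r. intro z. rewrite z in k_pos. discriminate.
Qed.

Local Notation "H [+] H'" := (CRle_plus H H') (at level 50, left associativity).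
Local Notation "H [<] H'" := (CRltProp_plus H H') (at level 50, left associativity).

(* Closes [x <= y] or [x < y] when [k * (y - x)] equals, as a ring identity, the right
   side minus the left side of the inequality [H], a sum of hypotheses. *)
Ltac linear_over k H :=
  first [apply (CRle_of_scaled_sub k _ _ _ _ eq_refl H)
        | apply (CRltProp_of_scaled_sub k _ _ _ _ eq_refl H)]; ring.

Ltac linear H := linear_over 1%Q H.

Lemma CR_half_pos (x : CRcarrier R) : 0 < x -> 0 < inj (1 # 2) * x.
Proof. intro H. linear_over 2%Q H. Qed.

Lemma CRmin_pos (x y : CRcarrier R) : 0 < x -> 0 < y -> 0 < CRmin x y.
Proof. intros H H'. apply CRltForget, CRmin_lt; apply CRltEpsilon; assumption. Qed.

Lemma CRabs_sub_bounds (x y a : CRcarrier R) : CRabs R (x - y) <= a -> x <= y + a /\ y <= x + a.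
Proof.
  intro H. split.
  - linear (CRle_abs (x - y) [+] H).
  - rewrite CRabs_minus_sym in H. linear (CRle_abs (y - x) [+] H).
Qed.

Lemma CRabs_sub_le (x y a : CRcarrier R) : x <= y + a -> y <= x + a -> CRabs R (x - y) <= a.
Proof. intros H H'. apply CRabs_le. split; [linear H' | linear H]. Qed.

Lemma CRabs_sub_triangle (x y z : CRcarrier R) : CRabs R (x - z) <= CRabs R (x - y) + CRabs R (y - z).
Proof. apply (dist_triangle R (real_metric R)). Qed.

(** * Rational tolerances and finite minima *)

Lemma CR_of_Q_pos q : (0 < q)%Q -> 0 < inj q.
Proof. intro H. apply CRltForget, CR_of_Q_lt, H. Qed.

(* Tolerances telescope: a step from level n to n+1 may move values and points by
   [err n - err (n+1)], so that all later steps together stay within [err n]. *)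
Definition err (n : nat) : Q := 1 # Pos.of_succ_nat n.

Lemma err_le m n : (m <= n)%nat -> (err n <= err m)%Q.
Proof. intro H. unfold Qle; simpl. lia. Qed.

Lemma err_succ_lt n : (err (S n) < err n)%Q.
Proof. unfold Qlt; simpl. lia. Qed.

Lemma err_half n : (err n <= 2 * err (S n))%Q.
Proof. unfold Qle; simpl. lia. Qed.

Lemma err_small (x : CRcarrier R) : 0 < x -> exists N, forall n, (N <= n)%nat -> inj (err n) < x.
Proof.
  intro H. destruct (CR_Q_dense R _ _ (CRltEpsilon R _ _ H)) as [q [q_pos q_lt]].
  exists (Pos.to_nat (Qden q)). intros n n_ge. apply CRltForget.
  apply (CRlt_trans _ (inj q)); [| exact q_lt].
  apply CR_of_Q_lt. apply lt_CR_of_Q in q_pos.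
  destruct q as [[| a | a] b]; unfold Qlt in *; simpl in *; try lia. nia.
Qed.

(** Removes the error terms left by finite levels. As [<=] negates [<], it suffices to refute
    [y < x], at a level with [err n] below [(x - y) / c]. *)
Lemma CRle_of_le_plus_err (c : positive) N (x y : CRcarrier R) :
  (forall n, (N <= n)%nat -> x <= y + inj (Zpos c # 1) * inj (err n)) -> x <= y.
Proof.
  intro H. apply CRle_not_ltProp. intro h.
  assert (P : 0 < inj (1 # c) * (x - y)).
  { assert (P : 0 < x - y) by linear h.
    apply (CRltProp_of_scaled_sub (Zpos c # 1) _ _ _ _ eq_refl P).
    setoid_replace (inj (Zpos c # 1) * (inj (1 # c) * (x - y) - 0))
      with (inj (Zpos c # 1) * inj (1 # c) * (x - y)) by ring.
    rewrite <- CR_of_Q_mult.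
    setoid_replace ((Zpos c # 1) * (1 # c))%Q with 1%Q; [ring |].
    unfold Qeq; simpl; lia. }
  destruct (err_small _ P) as [M M_lt].
  specialize (M_lt (max M N) ltac:(lia)). specialize (H (max M N) ltac:(lia)).
  set (e := inj (err (max M N))) in *.
  apply (CRle_ltProp_absurd _ _ H).
  apply (CRltProp_of_scaled_sub (1 # c) _ _ _ _ eq_refl M_lt).
  setoid_replace (inj (1 # c) * (x - (y + inj (Z.pos c # 1) * e)))
    with (inj (1 # c) * (x - y) - inj (1 # c) * inj (Z.pos c # 1) * e) by ring.
  rewrite <- CR_of_Q_mult.
  setoid_replace ((1 # c) * (Zpos c # 1))%Q with 1%Q; [ring |].
  unfold Qeq; simpl; lia.
Qed.

(* The cap 1 makes the minimum of the empty list harmless. *)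
Definition capped_min {A : Type} (f : A -> CRcarrier R) (l : list A) : CRcarrier R :=
  fold_right (fun u r => CRmin (f u) r) 1 l.

Lemma capped_min_le_1 {A} (f : A -> CRcarrier R) l : capped_min f l <= 1.
Proof.
  induction l as [| u l IH]; [apply CRle_refl |].
  exact (CRle_trans _ _ _ (CRmin_r _ _) IH).
Qed.

Lemma capped_min_le {A} (f : A -> CRcarrier R) l u : In u l -> capped_min f l <= f u.
Proof.
  induction l as [| v l IH]; intros []; simpl.
  - subst v. apply CRmin_l.
  - exact (CRle_trans _ _ _ (CRmin_r _ _) (IH H)).
Qed.

Lemma capped_min_glb {A} (f : A -> CRcarrier R) l (a : CRcarrier R) :
  a <= 1 -> (forall u, In u l -> a <= f u) -> a <= capped_min f l.
Proof.
  intros H H'. induction l as [| v l IH]; [exact H |]. simpl. apply CRmin_glb.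
  - apply H'. left; reflexivity.
  - apply IH. intros u Hu. apply H'. right; exact Hu.
Qed.

(** * A tree of nodes placed in the unit interval *)

Section Tree.
Context (width : nat -> nat) (edge : nat -> nat -> nat -> bool) (h : nat -> nat -> CRcarrier R).

(* A node [u] of level [n] owns the interval [fst u, fst u + scale (n+1) / 2], which
   contains the intervals of its descendants; nodes of level [n] are at least
   [3 * scale (n+1)] apart. *)
Fixpoint scale (n : nat) : Q :=
  match n with
  | O => 1
  | S m => scale m * (1 # Pos.of_nat (6 * width m + 6))
  end.

Lemma scale_pos n : (0 < scale n)%Q.
Proof.
  induction n; [reflexivity |]. simpl scale.
  apply Qmult_lt_0_compat; [assumption | reflexivity].
Qed.

Lemma scale_succ n : (scale (S n) * (6 * inject_Z (Z.of_nat (width n)) + 6) == scale n)%Q.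
Proof.
  simpl scale. rewrite <- Qmult_assoc.
  setoid_replace ((1 # Pos.of_nat (6 * width n + 6)) * (6 * inject_Z (Z.of_nat (width n)) + 6))%Q
    with 1%Q; [ring |].
  assert (H : Zpos (Pos.of_nat (6 * width n + 6)) = (6 * Z.of_nat (width n) + 6)%Z) by lia.
  set (p := Pos.of_nat _) in *. unfold Qeq; cbn -[Z.mul Z.add]. lia.
Qed.

Lemma scale_succ_le n : (6 * scale (S n) <= scale n)%Q.
Proof.
  pose proof (scale_pos (S n)). rewrite <- (scale_succ n).
  assert (0 <= inject_Z (Z.of_nat (width n)))%Q by (unfold Qle; simpl; lia).
  assert (0 <= scale (S n) * inject_Z (Z.of_nat (width n)))%Q
    by (apply Qmult_le_0_compat; lra).
  lra.
Qed.

Lemma scale_le_err n : (scale n <= err n)%Q.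
Proof.
  induction n; [discriminate |].
  pose proof (scale_succ_le n). pose proof (err_half n). pose proof (scale_pos n). lra.
Qed.

(** Offset of a node inside its parent's interval (for a root, inside [0, 1/2]). The spacing is six
    times the length of the interval that each node owns. *)
Definition slot (n j : nat) : Q := 3 * scale (S n) * inject_Z (Z.of_nat j).

(** Of the [6 * width n + 6] parts of [scale n], twice an offset takes at most [6 * width n]; the
    node's own interval fits in the rest. *)
Lemma slot_bounds n j :
  (j < width n)%nat -> (0 <= slot n j)%Q /\ (2 * slot n j + scale (S n) <= scale n)%Q.
Proof.
  intro H. pose proof (scale_pos (S n)). rewrite <- (scale_succ n). unfold slot.
  assert (0 <= inject_Z (Z.of_nat j))%Q by (unfold Qle; simpl; lia).
  assert (inject_Z (Z.of_nat j) <= inject_Z (Z.of_nat (width n)))%Q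
    by (rewrite <- Zle_Qle; lia).
  assert (0 <= scale (S n) * inject_Z (Z.of_nat j))%Q by (apply Qmult_le_0_compat; lra).
  assert (scale (S n) * inject_Z (Z.of_nat j) <=
          scale (S n) * inject_Z (Z.of_nat (width n)))%Q by (apply Qmult_le_l; lra).
  split; lra.
Qed.

Lemma slot_separated n i j : (i < j)%nat -> (slot n i + 3 * scale (S n) <= slot n j)%Q.
Proof.
  intro H. pose proof (scale_pos (S n)). unfold slot.
  assert (inject_Z (Z.of_nat i) + 1 <= inject_Z (Z.of_nat j))%Q.
  { change 1%Q with (inject_Z 1). rewrite <- inject_Z_plus, <- Zle_Qle. lia. }
  assert (scale (S n) * (inject_Z (Z.of_nat i) + 1) <=
          scale (S n) * inject_Z (Z.of_nat j))%Q by (apply Qmult_le_l; lra).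
  lra.
Qed.

Definition node : Type := (Q * nat)%type.

Definition child (n : nat) (u v : node) : Prop :=
  (snd v < width (S n))%nat /\ edge n (snd u) (snd v) = true /\
  fst v = (fst u + slot (S n) (snd v))%Q.

Fixpoint level (n : nat) : list node :=
  match n with
  | O => map (fun j => (slot 0 j, j)) (seq 0 (width 0))
  | S m => flat_map
      (fun u => map (fun j => ((fst u + slot (S m) j)%Q, j))
                  (filter (edge m (snd u)) (seq 0 (width (S m)))))
      (level m)
  end.

Lemma in_level_0 v : In v (level 0) <-> (snd v < width 0)%nat /\ fst v = slot 0 (snd v).
Proof.
  simpl. rewrite in_map_iff. split.
  - intros [j [<- H]]. apply in_seq in H. simpl. split; [lia | reflexivity].
  - destruct v as [p j]; simpl. intros [H ->]. exists j. split; [reflexivity |].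
    apply in_seq. lia.
Qed.

Lemma in_level_succ n v : In v (level (S n)) <-> exists u, In u (level n) /\ child n u v.
Proof.
  simpl. rewrite in_flat_map. split.
  - intros [u [Hu H]]. exists u. split; [exact Hu |].
    apply in_map_iff in H. destruct H as [j [<- H]].
    apply filter_In in H. destruct H as [H E]. apply in_seq in H.
    repeat split; [simpl; lia | exact E].
  - intros [u [Hu [H [E F]]]]. exists u. split; [exact Hu |].
    apply in_map_iff. exists (snd v). destruct v as [p j]; simpl in *. subst p.
    split; [reflexivity |]. apply filter_In. split; [apply in_seq; lia | exact E].
Qed.

Lemma level_width n v : In v (level n) -> (snd v < width n)%nat.
Proof.
  destruct n; intro H.
  - apply in_level_0 in H. apply H.
  - apply in_level_succ in H. destruct H as [u [_ H]]. apply H.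
Qed.

Lemma child_bounds n u v :
  child n u v ->
  (fst u <= fst v)%Q /\ (2 * fst v + scale (S (S n)) <= 2 * fst u + scale (S n))%Q.
Proof.
  intros [H [_ E]]. destruct (slot_bounds _ _ H). rewrite E. split; lra.
Qed.

Lemma level_bounds n v :
  In v (level n) -> (0 <= fst v)%Q /\ (2 * fst v + scale (S n) <= 1)%Q.
Proof.
  revert v. induction n; intros v H.
  - apply in_level_0 in H. destruct H as [H ->]. destruct (slot_bounds _ _ H).
    change (scale 0) with 1%Q in *. split; assumption.
  - apply in_level_succ in H. destruct H as [u [Hu H]].
    apply child_bounds in H. apply IHn in Hu. split; lra.
Qed.

(** Siblings are kept apart by their slots. Otherwise the parents are [3 * scale (S n)] apart and
    each child drifts right by at most half of [scale (S n)], which leaves more than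
    [3 * scale (S (S n))]. *)
Lemma level_separated n u v :
  In u (level n) -> In v (level n) ->
  u = v \/ (fst u + 3 * scale (S n) <= fst v)%Q \/ (fst v + 3 * scale (S n) <= fst u)%Q.
Proof.
  revert u v. induction n; intros [p i] [q j] Hu Hv.
  - apply in_level_0 in Hu, Hv. simpl fst in *; simpl snd in *.
    destruct Hu as [_ ->], Hv as [_ ->].
    destruct (Nat.lt_trichotomy i j) as [H | [-> | H]].
    + right; left. apply slot_separated, H.
    + left; reflexivity.
    + right; right. apply slot_separated, H.
  - apply in_level_succ in Hu, Hv.
    destruct Hu as [u' [Hu' Hu]], Hv as [v' [Hv' Hv]].
    destruct (IHn _ _ Hu' Hv') as [<- | H].
    + destruct Hu as [_ [_ Eu]], Hv as [_ [_ Ev]]. cbn [fst snd] in *. subst p q.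
      destruct (Nat.lt_trichotomy i j) as [H | [-> | H]].
      * right; left. pose proof (slot_separated (S n) _ _ H). lra.
      * left; reflexivity.
      * right; right. pose proof (slot_separated (S n) _ _ H). lra.
    + right. apply child_bounds in Hu, Hv.
      pose proof (scale_succ_le (S n)). pose proof (scale_pos (S n)).
      destruct H; [left | right]; lra.
Qed.

(** * Positions and values along descents *)

Context (edge_jump : forall n i j, edge n i j = true ->
  CRabs R (h n i - h (S n) j) <= inj (err n) - inj (err (S n))).
Context (edge_total : forall n i, (i < width n)%nat ->
  exists j, (j < width (S n))%nat /\ edge n i j = true).

(** Records the nesting of intervals and the drift of values instead of a path of edges; both bounds
    telescope, so the relation is transitive. *)
Definition below (n : nat) (u : node) (m : nat) (v : node) : Prop :=
  (fst u <= fst v)%Q /\ (2 * fst v + scale (S m) <= 2 * fst u + scale (S n))%Q /\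
  CRabs R (h n (snd u) - h m (snd v)) <= inj (err n) - inj (err m).

Lemma below_refl n u : below n u n u.
Proof.
  split; [lra |]. split; [lra |].
  apply CRabs_sub_le; linear (CRle_refl (h n (snd u))).
Qed.

Lemma below_trans n u m v l w : below n u m v -> below m v l w -> below n u l w.
Proof.
  intros [A [B C]] [A' [B' C']]. split; [lra |]. split; [lra |].
  linear (CRabs_sub_triangle (h n (snd u)) (h m (snd v)) (h l (snd w)) [+] C [+] C').
Qed.

Lemma child_below n u v : child n u v -> below n u (S n) v.
Proof.
  intro H. destruct (child_bounds _ _ _ H). split; [assumption |]. split; [assumption |].
  apply edge_jump, H.
Qed.

Lemma level_child n u : In u (level n) -> exists v, In v (level (S n)) /\ child n u v.
Proof.
  intro H. destruct (edge_total n (snd u) (level_width _ _ H)) as [j [j_lt E]].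
  assert (C : child n u ((fst u + slot (S n) j)%Q, j)) by (repeat split; assumption).
  exists ((fst u + slot (S n) j)%Q, j). split; [apply in_level_succ; exists u; auto | exact C].
Qed.

Lemma level_ancestor n d v :
  In v (level (d + n)) -> exists u, In u (level n) /\ below n u (d + n) v.
Proof.
  revert v. induction d; intros v H.
  - exists v. split; [exact H | apply below_refl].
  - apply (in_level_succ (d + n)) in H. destruct H as [w [Hw C]].
    destruct (IHd _ Hw) as [u [Hu B]]. exists u. split; [exact Hu |].
    exact (below_trans _ _ _ _ _ _ B (child_below _ _ _ C)).
Qed.

Lemma level_descendant n d u :
  In u (level n) -> exists v, In v (level (d + n)) /\ below n u (d + n) v.
Proof.
  intro H. induction d.
  - exists u. split; [exact H | apply below_refl].
  - destruct IHd as [w [Hw B]]. destruct (level_child _ _ Hw) as [v [Hv C]].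
    exists v. split; [exact Hv |].
    exact (below_trans _ _ _ _ _ _ B (child_below _ _ _ C)).
Qed.

Definition pos (u : node) : CRcarrier R := inj (fst u).

Lemma below_pos n u m v :
  below n u m v -> pos u <= pos v /\ 2 * pos v + inj (scale (S m)) <= 2 * pos u + inj (scale (S n)).
Proof.
  intros [A [B _]]. split; [apply CR_of_Q_le, A |].
  unfold pos. rewrite <- !CR_of_Q_mult, <- !CR_of_Q_plus. apply CR_of_Q_le, B.
Qed.

(** A descendant lies to the right of [u] by at most half of [scale (S n) - scale (S m)], so its
    distance to [t] falls by no more than that. *)
Lemma below_far n u m v t (a : CRcarrier R) :
  below n u m v -> a <= CRabs R (t - pos u) ->
  2 * a + inj (scale (S m)) <= 2 * CRabs R (t - pos v) + inj (scale (S n)).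
Proof.
  intros B H. destruct (below_pos _ _ _ _ B) as [P P'].
  assert (D : CRabs R (pos v - pos u) == pos v - pos u)
    by (apply CRabs_right; linear P).
  pose proof (CRabs_sub_triangle t (pos v) (pos u)) as T. rewrite D in T.
  linear (T [+] T [+] H [+] H [+] P').
Qed.

(** * The envelope of the tree *)

Definition weight (n : nat) (t : CRcarrier R) (u : node) : CRcarrier R :=
  h n (snd u) + CRabs R (t - pos u).

Lemma below_weight n u m v t :
  below n u m v -> weight n t u <= weight m t v + 2 * inj (err n) /\
                   weight m t v <= weight n t u + 2 * inj (err n).
Proof.
  intro B. destruct (below_pos _ _ _ _ B) as [P P'].
  destruct (CRabs_sub_bounds _ _ _ (proj2 (proj2 B))) as [J J'].
  assert (M : 0 <= inj (err m)) by (apply CR_of_Q_le; discriminate).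
  assert (N : inj (scale (S n)) <= inj (err n)).
  { apply CR_of_Q_le. pose proof (scale_le_err n).
    pose proof (scale_succ_le n). pose proof (scale_pos (S n)). lra. }
  assert (L : 0 <= inj (scale (S m))) by (apply CR_of_Q_le, Qlt_le_weak, scale_pos).
  assert (N' : 0 <= inj (err n)) by (apply CR_of_Q_le; discriminate).
  assert (D : CRabs R (pos v - pos u) == pos v - pos u)
    by (apply CRabs_right; linear P).
  assert (D' : CRabs R (pos u - pos v) == pos v - pos u)
    by (rewrite CRabs_minus_sym; exact D).
  pose proof (CRabs_sub_triangle t (pos v) (pos u)) as T. rewrite D in T.
  pose proof (CRabs_sub_triangle t (pos u) (pos v)) as T'. rewrite D' in T'.
  unfold weight. split.
  - linear_over 2%Q (T [+] T [+] J [+] J [+] M [+] M [+] P' [+] L [+] N [+] N').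
  - linear_over 2%Q (T' [+] T' [+] J' [+] J' [+] M [+] M [+] P' [+] L [+] N [+] N').
Qed.

Definition approx (n : nat) (t : CRcarrier R) : CRcarrier R := capped_min (weight n t) (level n).

Lemma approx_le_1 n t : approx n t <= 1.
Proof. apply capped_min_le_1. Qed.

Lemma approx_le n t u : In u (level n) -> approx n t <= weight n t u.
Proof. apply (capped_min_le (weight n t)). Qed.

Lemma approx_lipschitz n s t : approx n s <= approx n t + CRabs R (s - t).
Proof.
  assert (H : approx n s - CRabs R (s - t) <= approx n t).
  { apply capped_min_glb.
    - linear (approx_le_1 n s [+] CRabs_pos (s - t)).
    - intros u Hu. pose proof (approx_le n s u Hu) as W. unfold weight in *.
      linear (W [+] CRabs_sub_triangle s t (pos u)). }
  linear H.
Qed.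

(** Each node of level [m] is compared with an ancestor in level [n], and each node of level [n]
    with a descendant in level [m], which exists since no node is childless. *)
Lemma approx_cauchy n m t :
  (n <= m)%nat -> CRabs R (approx n t - approx m t) <= 2 * inj (err n).
Proof.
  intro H. replace m with (m - n + n)%nat by lia. generalize (m - n)%nat as d. clear m H. intro d.
  assert (N : 0 <= inj (err n)) by (apply CR_of_Q_le; discriminate).
  apply CRabs_sub_le.
  - assert (H : approx n t - 2 * inj (err n) <= approx (d + n) t).
    { apply capped_min_glb.
      - linear (approx_le_1 n t [+] N [+] N).
      - intros v Hv. destruct (level_ancestor _ _ _ Hv) as [u [Hu B]].
        linear (approx_le n t _ Hu [+] proj1 (below_weight _ _ _ _ t B)). }
    linear H.
  - assert (H : approx (d + n) t - 2 * inj (err n) <= approx n t).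
    { apply capped_min_glb.
      - linear (approx_le_1 (d + n) t [+] N [+] N).
      - intros u Hu. destruct (level_descendant _ d _ Hu) as [v [Hv B]].
        linear (approx_le (d + n) t _ Hv [+] proj2 (below_weight _ _ _ _ t B)). }
    linear H.
Qed.

Lemma approx_CR_cauchy t : CR_cauchy R (fun n => approx n t).
Proof.
  intro p. exists (Pos.to_nat (2 * p)).
  assert (H : forall i j, (Pos.to_nat (2 * p) <= i)%nat -> (i <= j)%nat ->
    CRabs R (approx i t - approx j t) <= inj (1 # p)).
  { intros i j Hi Hij. apply (CRle_trans _ _ _ (approx_cauchy i j t Hij)).
    rewrite <- CR_of_Q_mult. apply CR_of_Q_le. unfold Qle; simpl. lia. }
  intros i j Hi Hj. destruct (Nat.le_ge_cases i j) as [L | L].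
  - apply H; assumption.
  - rewrite CRabs_minus_sym. apply H; assumption.
Qed.

Definition envelope (t : CRcarrier R) : CRcarrier R :=
  projT1 (CR_complete R _ (approx_CR_cauchy t)).

Lemma envelope_approx n t :
  envelope t <= approx n t + 2 * inj (err n) /\ approx n t <= envelope t + 2 * inj (err n).
Proof.
  unfold envelope. destruct (CR_complete R _ (approx_CR_cauchy t)) as [l Hl]. simpl. split.
  - apply (CR_cv_bound_up _ _ _ n) with (2 := Hl). intros m Hm.
    exact (proj2 (CRabs_sub_bounds _ _ _ (approx_cauchy n m t Hm))).
  - assert (H : approx n t - 2 * inj (err n) <= l).
    { apply (CR_cv_bound_down _ _ _ n) with (2 := Hl). intros m Hm.
      linear (proj1 (CRabs_sub_bounds _ _ _ (approx_cauchy n m t Hm))). }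
    linear H.
Qed.

Lemma envelope_lipschitz s t : envelope s <= envelope t + CRabs R (s - t).
Proof.
  (* Each of the two passages between [envelope] and [approx] costs [2 * err n]. *)
  apply (CRle_of_le_plus_err 4 0). intros n _.
  linear (proj1 (envelope_approx n s) [+] approx_lipschitz n s t [+] proj2 (envelope_approx n t)).
Qed.

Lemma envelope_le n u : In u (level n) -> envelope (pos u) <= h n (snd u) + 2 * inj (err n).
Proof.
  intro H. pose proof (approx_le n (pos u) u H) as W. unfold weight in W.
  rewrite (proj2 (CR_sub_eq0 (pos u) (pos u))) in W by reflexivity.
  linear (proj1 (envelope_approx n (pos u)) [+] W).
Qed.

(** * Isolating branches and positivity of the envelope *)

Context (width_0 : (0 < width 0)%nat).

Lemma level_nonempty n : exists u, In u (level n).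
Proof.
  induction n as [| n [u H]].
  - exists (slot 0 0, O). apply in_level_0. split; [exact width_0 | reflexivity].
  - destruct (level_child _ _ H) as [v [Hv _]]. exists v. exact Hv.
Qed.

(** Whether [u] itself is close to [t] stays open, which avoids deciding which nodes are close. *)
Definition isolates (n : nat) (t : CRcarrier R) (u : node) : Prop :=
  forall v, In v (level n) -> v = u \/ inj (scale (S n)) <= CRabs R (t - pos v).

(** Cotransitivity tests each node against [scale (S n)] and [2 * scale (S n)]. If some node lies
    within the larger bound, the separation [3 * scale (S n)] pushes all others beyond the smaller
    one; if none is found, all nodes are far and any node serves. *)
Lemma level_isolating n t : exists u, In u (level n) /\ isolates n t u.
Proof.
  assert (S_pos : 0 < inj (scale (S n))) by (apply CR_of_Q_pos, scale_pos).
  assert (H : forall l, (exists u, In u l /\ CRabs R (t - pos u) <= 2 * inj (scale (S n))) \/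
    (forall u, In u l -> inj (scale (S n)) <= CRabs R (t - pos u))).
  { induction l as [| v l [[u [Hu H]] | H]]; [right; intros _ [] | |].
    - left. exists u. split; [right; exact Hu | exact H].
    - destruct (CRltProp_cotrans (inj (scale (S n))) (CRabs R (t - pos v)) (2 * inj (scale (S n))))
        as [L | L].
      + linear S_pos.
      + right. intros u [<- | Hu]; [apply CRltProp_le, L | apply H, Hu].
      + left. exists v. split; [left; reflexivity | apply CRltProp_le, L]. }
  destruct (H (level n)) as [[u [Hu N]] | F].
  - exists u. split; [exact Hu |]. intros v Hv.
    destruct (level_separated n v u Hv Hu) as [E | G]; [left; exact E | right].
    assert (D : 3 * inj (scale (S n)) <= CRabs R (pos v - pos u)).
    { unfold pos. destruct G as [G | G]; apply (CR_of_Q_le (R := R)) in G;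
        rewrite CR_of_Q_plus, CR_of_Q_mult in G.
      - rewrite CRabs_minus_sym. linear (G [+] CRle_abs (inj (fst u) - inj (fst v))).
      - linear (G [+] CRle_abs (inj (fst v) - inj (fst u))). }
    pose proof (CRabs_sub_triangle (pos v) t (pos u)) as T.
    rewrite (CRabs_minus_sym (pos v) t) in T.
    linear (D [+] T [+] N).
  - destruct (level_nonempty n) as [u Hu]. exists u. split; [exact Hu |].
    intros v Hv. right. apply F, Hv.
Qed.

Lemma isolating_child n t u :
  In u (level n) -> isolates n t u ->
  exists v, In v (level (S n)) /\ isolates (S n) t v /\ child n u v.
Proof.
  intros Hu I. destruct (level_isolating (S n) t) as [v [Hv J]].
  destruct (proj1 (in_level_succ n v) Hv) as [w [Hw C]].
  destruct (I w Hw) as [-> | F].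
  - exists v. auto.
  - (* The node [v] isolated at the next level is far from [t], being a child of
       [w <> u]; then so is the whole level, and any child of [u] will do. *)
    destruct (level_child n u Hu) as [v' [Hv' C']]. exists v'. split; [exact Hv' |].
    split; [| exact C']. intros x Hx. right. destruct (J x Hx) as [-> | G]; [| exact G].
    assert (K : 3 * inj (scale (S (S n))) <= inj (scale (S n))).
    { rewrite <- CR_of_Q_mult. apply CR_of_Q_le.
      pose proof (scale_succ_le (S n)). pose proof (scale_pos (S (S n))). lra. }
    assert (L : 0 <= inj (scale (S (S n)))) by (apply CR_of_Q_le, Qlt_le_weak, scale_pos).
    (* Passing to the child loses at most half of [scale (S n)]; the other half is at least
       [3/2 * scale (S (S n))]. *)
    linear_over 2%Q (below_far _ _ _ _ _ _ (child_below _ _ _ C) F [+] K [+] L [+] L).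
Qed.

Definition branch (j : nat -> nat) : Prop :=
  forall n, (j n < width n)%nat /\ edge n (j n) (j (S n)) = true.

Lemma isolating_branch (DC : FunctionalDependentChoice) t :
  exists j, branch j /\
    forall n, exists u, In u (level n) /\ snd u = j n /\ isolates n t u.
Proof.
  destruct (level_isolating 0 t) as [u0 [Hu0 I0]].
  (* Dependent choice works on one type, so the level is carried in the state and the relation
     raises it by one. *)
  pose (state := {s : nat * node | In (snd s) (level (fst s)) /\ isolates (fst s) t (snd s)}).
  destruct (DC state (fun s s' => fst (proj1_sig s') = S (fst (proj1_sig s)) /\
      child (fst (proj1_sig s)) (snd (proj1_sig s)) (snd (proj1_sig s'))))
    with (x0 := exist _ (O, u0) (conj Hu0 I0) : state) as [s [s0 Hs]].
  - intros [[n u] [Hu I]]. simpl in *.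
    destruct (isolating_child n t u Hu I) as [v [Hv [J C]]].
    exists (exist _ (S n, v) (conj Hv J)). simpl. auto.
  - assert (fst_s : forall n, fst (proj1_sig (s n)) = n).
    { induction n; [rewrite s0; reflexivity | rewrite (proj1 (Hs n)), IHn; reflexivity]. }
    exists (fun n => snd (snd (proj1_sig (s n)))). split.
    + intro n. destruct (proj2_sig (s n)) as [L _]. destruct (Hs n) as [_ C].
      rewrite fst_s in L, C. split; [apply level_width, L | apply C].
    + intro n. exists (snd (proj1_sig (s n))).
      destruct (proj2_sig (s n)) as [L I]. rewrite fst_s in L, I. auto.
Qed.

Context (h_nonneg : forall n j, 0 <= h n j).
Context (branch_pos : forall j, branch j ->
  exists a N, 0 < a /\ forall n, (N <= n)%nat -> a <= h n (j n)).

(** Take [n] with [err n < a / 2]. A later node below the isolated node of level [n] has value at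
    least [a / 2]; any other later node descends from a node far from [t], so it stays at least half
    of [scale (S n)] away from [t]. *)
Lemma envelope_pos (DC : FunctionalDependentChoice) t : 0 < envelope t.
Proof.
  destruct (isolating_branch DC t) as [j [Hj I]].
  destruct (branch_pos j Hj) as [a [N [a_pos Ha]]].
  destruct (err_small (inj (1 # 2) * a) (CR_half_pos _ a_pos)) as [M HM].
  set (n := max N M). specialize (HM n ltac:(lia)). specialize (Ha n ltac:(lia)).
  destruct (I n) as [u [Hu [Eu Iu]]]. rewrite <- Eu in Ha.
  pose (b := CRmin (inj (1 # 2) * a) (inj (1 # 2) * inj (scale (S n)))).
  assert (S_pos : 0 < inj (scale (S n))) by apply CR_of_Q_pos, scale_pos.
  assert (b_pos : 0 < b) by (apply CRmin_pos; apply CR_half_pos; assumption).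
  assert (b_a : b <= inj (1 # 2) * a) by apply CRmin_l.
  assert (b_s : b <= inj (1 # 2) * inj (scale (S n))) by apply CRmin_r.
  apply (CRltProp_le_trans _ _ _ b_pos).
  apply (CRle_of_le_plus_err 2 n). intros m Hm.
  refine (CRle_trans _ _ _ _ (proj2 (envelope_approx m t))).
  apply capped_min_glb.
  - assert (S_1 : inj (scale (S n)) <= 1).
    { apply CR_of_Q_le. pose proof (scale_le_err (S n)).
      pose proof (err_le 0 (S n) ltac:(lia)) as H'. change (err 0) with 1%Q in H'. lra. }
    linear_over 2%Q (b_s [+] b_s [+] S_1 [+] CRltProp_le (CR_of_Q_pos 1 eq_refl)).
  - intros v Hv. unfold weight.
    replace m with (m - n + n)%nat in Hv by lia.
    destruct (level_ancestor _ _ _ Hv) as [w [Hw B]].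
    replace (m - n + n)%nat with m in B by lia.
    destruct (Iu w Hw) as [-> | F].
    + destruct (CRabs_sub_bounds _ _ _ (proj2 (proj2 B))) as [J _].
      assert (P : 0 <= inj (err m)) by (apply CR_of_Q_le; discriminate).
      linear (b_a [+] Ha [+] J [+] CRltProp_le HM [+] CRabs_pos (t - pos v) [+] P).
    + assert (P : 0 <= inj (scale (S m))) by (apply CR_of_Q_le, Qlt_le_weak, scale_pos).
      linear_over 2%Q (b_s [+] b_s [+] below_far _ _ _ _ _ _ B F [+] P
                         [+] h_nonneg m (snd v) [+] h_nonneg m (snd v)).
Qed.

Lemma branch_level j : branch j -> forall n, exists u, In u (level n) /\ snd u = j n.
Proof.
  intros H n. induction n as [| n [u [Hu E]]].
  - exists (slot 0 (j O), j O). split; [| reflexivity].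
    apply in_level_0. split; [apply H | reflexivity].
  - exists ((fst u + slot (S n) (j (S n)))%Q, j (S n)). split; [| reflexivity].
    apply in_level_succ. exists u. split; [exact Hu |].
    split; [apply H | split; [rewrite E; apply H | reflexivity]].
Qed.

(** The nodes of a branch sit at points of [0,1], where the infimum of the envelope bounds their
    values from below up to [2 * err n]. *)
Lemma branches_bounded_below (DC : FunctionalDependentChoice) (POS : POS01 R) :
  exists a, 0 < a /\ forall j, branch j -> forall n, a <= h n (j n) + 2 * inj (err n).
Proof.
  destruct (POS (fun t => envelope (proj1_sig t))) as [a [[a_le _] a_pos]].
  - intros eps eps_pos. exists eps. split; [exact eps_pos |]. intros s t H.
    refine (CRle_ltProp_trans _ _ _ _ H). simpl. apply CRabs_sub_le.
    + apply envelope_lipschitz.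
    + rewrite CRabs_minus_sym. apply envelope_lipschitz.
  - intro t. apply (envelope_pos DC).
  - exists a. split; [exact a_pos |]. intros j Hj n.
    destruct (branch_level j Hj n) as [u [Hu <-]].
    refine (CRle_trans _ _ _ _ (envelope_le n u Hu)).
    destruct (level_bounds n u Hu) as [u_ge u_le]. pose proof (scale_pos (S n)).
    assert (u_01 : 0 <= pos u /\ pos u <= 1) by (split; apply CR_of_Q_le; lra).
    exact (a_le (exist _ (pos u) u_01) I).
Qed.

End Tree.

(** * From the unit interval to compact spaces *)

(* [h x r] reads "h(x) = r": a total relation need not come from a function
   on [X], since no choice over [X] is available. *)
Theorem positive_bounded_below_on_compact (DC : FunctionalDependentChoice) (POS : POS01 R)
    (X : MetricSpace R) (X_compact : compact X) (x0 : X)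
    (h : X -> CRcarrier R -> Prop)
    (h_total : forall x : X, exists r, h x r)
    (h_pos : forall (x : X) r, h x r -> 0 < r)
    (h_uniformly_continuous : forall eps, 0 < eps -> exists delta, 0 < delta /\
      forall (x x' : X) r r', dist x x' < delta -> h x r -> h x' r' -> CRabs R (r - r') <= eps) :
  exists m, 0 < m /\ forall (x : X) r, h x r -> m <= r.
Proof.
  assert (CC : FunctionalCountableChoice)
    by exact (functional_dependent_choice_imp_functional_countable_choice DC).
  assert (dist_self : forall x : X, dist x x <= 0).
  { intro x. apply (dist_eq0 R X x x), (ms_equiv R X). }
  assert (step_pos : forall n, 0 < inj (err n) - inj (err (S n))).
  { intro n. linear (CRltForget R _ _ (CR_of_Q_lt R _ _ (err_succ_lt n))). }
  (* [d n] is a modulus for one step of values and is itself at most that step, so that distances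
     along a branch telescope too. *)
  destruct (CC (CRcarrier R) (fun n d => 0 < d /\ d <= inj (err n) - inj (err (S n)) /\
    forall (x x' : X) r r', dist x x' < d -> h x r -> h x' r' ->
      CRabs R (r - r') <= inj (err n) - inj (err (S n)))) as [d d_spec].
  { intro n. destruct (h_uniformly_continuous _ (step_pos n)) as [e [e_pos He]].
    exists (CRmin e (inj (err n) - inj (err (S n)))).
    split; [apply CRmin_pos; auto |]. split; [apply CRmin_r |].
    intros x x' r r' H. apply He. exact (CRltProp_le_trans _ _ _ H (CRmin_l _ _)). }
  (* Level [n] must be fine enough for edges to the next level ([d n]) and from the previous one
     ([d (pred n)]); at level 0 the two conditions coincide. *)
  destruct (CC (list X) (fun n s => forall x : X, exists y : X, In y s /\
    dist x y < inj (1 # 4) * d n /\ dist x y < inj (1 # 4) * d (pred n))) as [net net_spec].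
  { intro n.
    destruct (proj2 X_compact (inj (1 # 4) * CRmin (d n) (d (pred n)))) as [s Hs].
    - pose proof (CRmin_pos _ _ (proj1 (d_spec n)) (proj1 (d_spec (pred n)))) as P.
      linear_over 4%Q P.
    - exists s. intro x. destruct (Hs x) as [y [Hy H]]. exists y. split; [exact Hy |].
      split; apply (CRltProp_le_trans _ _ _ H).
      + linear_over 4%Q (CRmin_l (d n) (d (pred n))).
      + linear_over 4%Q (CRmin_r (d n) (d (pred n))). }
  (* The default [x0] makes [pt n j] a point of [X] for every [j], so values can be chosen without
     bounding the index. *)
  pose (pt := fun n j => nth j (net n) x0).
  pose (width := fun n => length (net n)).
  assert (cover : forall n (x : X), exists j, (j < width n)%nat /\
    dist x (pt n j) < inj (1 # 4) * d n /\ dist x (pt n j) < inj (1 # 4) * d (pred n)).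
  { intros n x. destruct (net_spec n x) as [y [Hy H]].
    apply (In_nth _ _ x0) in Hy. destruct Hy as [j [Hj <-]]. exists j. auto. }
  destruct (CC (nat -> CRcarrier R) (fun n v => forall j, h (pt n j) (v j))) as [v v_spec].
  { intro n. apply (CC _ (fun j r => h (pt n j) r)). intro j. apply h_total. }
  (* [dist < d n] is not decidable; the two answers overlap between [d n / 2] and [d n], so
     cotransitivity provides one, and choice collects them into a Boolean function. *)
  pose (decides := fun n i j (b : bool) =>
    (b = true -> dist (pt n i) (pt (S n) j) < d n) /\
    (b = false -> inj (1 # 2) * d n <= dist (pt n i) (pt (S n) j))).
  destruct (CC (nat -> nat -> bool) (fun n E => forall i j, decides n i j (E i j))) as [edge edge_spec].
  { intro n. apply (CC _ (fun i e => forall j, decides n i j (e j))). intro i.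
    apply (CC _ (decides n i)). intro j. pose proof (proj1 (d_spec n)) as P.
    destruct (CRltProp_cotrans (inj (1 # 2) * d n) (dist (pt n i) (pt (S n) j)) (d n)) as [H | H].
    - linear_over 2%Q P.
    - exists false. split; [discriminate |]. intros _. apply CRltProp_le, H.
    - exists true. split; [|discriminate]. intros _. exact H. }
  (* Two distances below a quarter of [d n] add up to less than half of it, which excludes the
     answer [false]. *)
  assert (edge_of_close : forall n i j (x : X), dist x (pt n i) < inj (1 # 4) * d n ->
    dist x (pt (S n) j) < inj (1 # 4) * d n -> edge n i j = true).
  { intros n i j x H H'. destruct (edge n i j) eqn:E; [reflexivity |].
    exfalso. apply (proj2 (edge_spec n i j)) in E. apply (CRle_ltProp_absurd _ _ E).
    pose proof (dist_triangle _ _ (pt n i) x (pt (S n) j)) as T.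
    rewrite (dist_sym _ _ (pt n i) x) in T. linear (H [<] CRltProp_le H' [<] T). }
  destruct (branches_bounded_below width edge v) as [m [m_pos m_le]].
  - intros n i j E. apply (proj2 (proj2 (d_spec n)) (pt n i) (pt (S n) j)); auto.
    apply edge_spec, E.
  - intros n i _. destruct (cover (S n) (pt n i)) as [j [Hj [_ H]]]. exists j.
    split; [exact Hj |]. apply (edge_of_close n i j (pt n i)); [| exact H].
    pose proof (proj1 (d_spec n)) as P.
    apply (CRle_ltProp_trans _ _ _ (dist_self _)). linear_over 4%Q P.
  - destruct (cover 0%nat x0) as [j [Hj _]]. lia.
  - intros n j. apply CRltProp_le, (h_pos (pt n j)), v_spec.
  - intros j Hj.
    (* By telescoping the branch is Cauchy. At its limit [l] the value [r] is positive, and late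
       values on the branch differ from it by at most [r / 2]. *)
    assert (far : forall n k, dist (pt n (j n)) (pt (k + n)%nat (j (k + n)%nat))
        <= inj (err n) - inj (err (k + n))).
    { intros n k. induction k; simpl.
      - linear (dist_self (pt n (j n))).
      - pose proof (proj1 (edge_spec _ _ _) (proj2 (Hj (k + n)%nat))) as H.
        linear (dist_triangle _ _ (pt n (j n)) (pt (k + n)%nat (j (k + n)%nat))
                  (pt (S (k + n)) (j (S (k + n)))) [+] IHk [+] CRltProp_le H
                  [+] proj1 (proj2 (d_spec (k + n)%nat))). }
    destruct (proj1 X_compact (fun n => pt n (j n))) as [l Hl].
    { intros eps eps_pos. destruct (err_small eps eps_pos) as [N HN]. exists N.
      assert (W : forall a b : nat, (N <= a)%nat -> (a <= b)%nat ->
        dist (pt a (j a)) (pt b (j b)) < eps).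
      { intros a b Ha Hb. pose proof (far a (b - a)%nat) as F.
        replace (b - a + a)%nat with b in F by lia.
        assert (P : 0 <= inj (err b)) by (apply CR_of_Q_le; discriminate).
        linear (HN a Ha [<] F [<] P). }
      intros a b Ha Hb. destruct (Nat.le_ge_cases a b) as [L | L]; [apply W; assumption |].
      refine (CRle_ltProp_trans _ _ _ _ (W b a Hb L)). apply dist_sym. }
    destruct (h_total l) as [r Hr]. pose proof (h_pos l r Hr) as r_pos.
    destruct (h_uniformly_continuous _ (CR_half_pos _ r_pos)) as [e [e_pos He]].
    destruct (Hl e e_pos) as [N HN]. exists (inj (1 # 2) * r), N.
    split; [apply CR_half_pos, r_pos |]. intros n Hn.
    destruct (CRabs_sub_bounds _ _ _ (He _ _ _ _ (HN n Hn) (v_spec n (j n)) Hr)) as [_ B].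
    linear B.
  - exact DC.
  - exact POS.
  - exists m. split; [exact m_pos |]. intros x r Hr.
    (* Every [x] is approached by a branch: a net point close to [x] is chosen at each level, and
       consecutive choices are joined by [edge_of_close]. *)
    destruct (CC nat (fun n j => (j < width n)%nat /\
      dist x (pt n j) < inj (1 # 4) * d n /\ dist x (pt n j) < inj (1 # 4) * d (pred n)))
      as [j Hj]; [intro n; apply cover |].
    assert (B : branch width edge j).
    { intro n. split; [apply Hj |]. apply (edge_of_close n _ _ x); [apply Hj |].
      exact (proj2 (proj2 (Hj (S n)))). }
    (* The 3 is [2 * err n] from the tree bound and [err n] from comparing [x] with its net
       point. *)
    apply (CRle_of_le_plus_err 3 0). intros n _.
    destruct (Hj n) as [_ [H _]].
    assert (H' : dist x (pt n (j n)) < d n).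
    { pose proof (CRltProp_le (proj1 (d_spec n))) as P.
      apply (CRltProp_le_trans _ _ _ H). linear_over 4%Q (P [+] P [+] P). }
    destruct (CRabs_sub_bounds _ _ _
      (proj2 (proj2 (d_spec n)) _ _ _ _ H' Hr (v_spec n (j n)))) as [_ C].
    assert (P : 0 <= inj (err (S n))) by (apply CR_of_Q_le; discriminate).
    linear (m_le j B n [+] C [+] P).
Qed.

(** * The norm of [f] combined with the distance to its zero set *)

Lemma is_inf_dist_lipschitz (X : MetricSpace R) (S : X -> Prop) (x x' : X) a b :
  is_inf S (fun y : X => dist x y) a -> is_inf S (fun y : X => dist x' y) b -> a <= b + dist x x'.
Proof.
  intros [a_le _] [_ b_inf]. apply CRle_not_ltProp. intro H.
  assert (P : 0 < a - b - dist x x') by linear H.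
  destruct (b_inf _ P) as [y [Hy L]]. apply (CRle_ltProp_absurd _ _ (a_le y Hy)).
  linear (L [<] dist_triangle _ _ x x' y).
Qed.

Lemma norm_le_sub_plus (Y : NormedSpace R) (u v : Y) :
  norm u <= norm v + norm (ns_add u (ns_opp v)).
Proof.
  pose proof (ns_equiv R Y) as Eq. pose proof (ns_add_proper R Y) as Add.
  assert (E : ns_eq u (ns_add (ns_add u (ns_opp v)) v)).
  { rewrite <- ns_add_assoc, (ns_add_comm _ _ (ns_opp v)), ns_add_opp, ns_add_comm, ns_add_zero.
    reflexivity. }
  rewrite (norm_proper R Y _ _ E). linear (norm_triangle R Y (ns_add u (ns_opp v)) v).
Qed.

Lemma CRmax_le_plus (a b a' b' x : CRcarrier R) :
  a <= a' + x -> b <= b' + x -> CRmax a b <= CRmax a' b' + x.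
Proof.
  intros H H'. apply CRmax_lub.
  - linear (H [+] CRmax_l a' b').
  - linear (H' [+] CRmax_r a' b').
Qed.

Section ZeroDistanceGap.
Context {X : MetricSpace R} {Y : NormedSpace R} (f : X -> Y) (eps : CRcarrier R).

(** A relation rather than a function, because locatedness only asserts that the distance [d]
    exists. *)
Definition gap (x : X) (r : CRcarrier R) : Prop :=
  exists d, is_inf (zero_set f) (fun y : X => dist x y) d /\ r = CRmax (norm (f x)) (eps - d).

Lemma gap_total : located (zero_set f) -> forall x, exists r, gap x r.
Proof. intros L x. destruct (L x) as [d Hd]. exists (CRmax (norm (f x)) (eps - d)), d. auto. Qed.

Lemma gap_pos (x : X) r : 0 < eps -> Z_stable_at f x -> gap x r -> 0 < r.
Proof.
  intros eps_pos stable [d [[d_le _] ->]].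
  destruct (stable eps eps_pos) as [delta [delta_pos H]].
  destruct (CRltProp_cotrans _ (norm (f x)) _ delta_pos) as [L | L].
  - exact (CRltProp_le_trans _ _ _ L (CRmax_l _ _)).
  - destruct (H L) as [y [Hy K]].
    refine (CRltProp_le_trans _ (eps - d) _ _ (CRmax_r _ _)).
    linear (K [<] d_le y Hy).
Qed.

Lemma gap_uniformly_continuous :
  @uniformly_continuous R X (normed_metric Y) f ->
  forall e, 0 < e -> exists delta, 0 < delta /\
    forall (x x' : X) r r', dist x x' < delta -> gap x r -> gap x' r' -> CRabs R (r - r') <= e.
Proof.
  intros f_uc e e_pos. destruct (f_uc e e_pos) as [delta [delta_pos H]].
  (* [delta] controls the norm; [e] controls the distance to the zero set, which is 1-Lipschitz. *)
  exists (CRmin delta e). split; [apply CRmin_pos; assumption |].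
  assert (W : forall (x x' : X) r r', dist x x' < CRmin delta e ->
    gap x r -> gap x' r' -> r <= r' + e).
  { intros x x' r r' L [d [Hd ->]] [d' [Hd' ->]]. apply CRmax_le_plus.
    - pose proof (CRltProp_le (H x x' (CRltProp_le_trans _ _ _ L (CRmin_l _ _)))) as F.
      exact (CRle_trans _ _ _ (norm_le_sub_plus Y (f x) (f x')) (CRplus_le_compat_l _ _ _ F)).
    - pose proof (is_inf_dist_lipschitz X _ x' x _ _ Hd' Hd) as D.
      rewrite dist_sym in D.
      linear (D [+] CRltProp_le L [+] CRmin_r delta e). }
  intros x x' r r' L G G'. apply CRabs_sub_le.
  - exact (W x x' r r' L G G').
  - apply (W x' x r' r); [| exact G' | exact G].
    refine (CRle_ltProp_trans _ _ _ _ L). apply dist_sym.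
Qed.

(** A maximum of at least [m] whose first entry is below [m] forces [m <= eps - d]; this slack
    absorbs the error in approximating the infimum [d] by a zero. *)
Lemma dist_to_zero_set_of_gap (x : X) m r :
  0 < m -> gap x r -> m <= r -> norm (f x) < m -> dist_to_lt x (zero_set f) eps.
Proof.
  intros m_pos [d [Hd ->]] M Hx.
  assert (L : m <= eps - d).
  { apply CRle_not_ltProp. intro L. apply M, CRmax_lub_lt; apply CRltEpsilon; assumption. }
  destruct (proj2 Hd m m_pos) as [y [Hy D]]. exists y. split; [exact Hy |].
  linear (D [<] L).
Qed.

End ZeroDistanceGap.
End Reals.

Theorem corollary3p3 (R : ConstructiveReals)
    (DC : FunctionalDependentChoice)
    (POS : POS01 R)
    (X : MetricSpace R) (X_compact : compact X)
    (Y : NormedSpace R)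
    (f : X -> Y)
    (f_Z_stable : Z_stable f)
    (f_uniformly_continuous : @uniformly_continuous R X (normed_metric Y) f)
    (Zf_inhabited : exists x : X, zero_set f x)
    (Zf_located : located (zero_set f)) :
  uniformly_Z_stable f.
Proof.
  intros eps eps_pos. destruct Zf_inhabited as [x0 _].
  destruct (positive_bounded_below_on_compact DC POS X X_compact x0 (gap f eps)
    (gap_total f eps Zf_located)
    (fun x r => gap_pos f eps x r eps_pos (f_Z_stable x))
    (gap_uniformly_continuous f eps f_uniformly_continuous)) as [m [m_pos m_le]].
  exists m. split; [exact m_pos |]. intros x Hx.
  destruct (gap_total f eps Zf_located x) as [r Hr].
  exact (dist_to_zero_set_of_gap f eps x m r m_pos Hr (m_le x r Hr) Hx).
Qed.
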